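(* Let $\&$ be a continuous t-norm and let $M>0$. Then the $[0,1]$-enriched category $(\mathbb{E}^1_{[-M,M]},P)$ is conically cocomplete and conically complete.
   Context: T-norms: a t-norm is a commutative, associative binary operation $\&$ on $[0,1]$, monotone in each variable, with $x\,\&\,1=x$. Its residual implication is $x\to y=\sup\{t\in[0,1]\mid x\,\&\,t\le y\}$. Fuzzy numbers: $\mathbb{E}^1$ is the set of functions $u:\mathbb{R}\to[0,1]$ such that (1) $u(x_0)=1$ for some $x_0$; (2) $u(\lambda x+(1-\lambda)y)\ge\min\{u(x),u(y)\}$ for all $x,y\in\mathbb{R},\lambda\in[0,1]$; (3) $u$ is upper-semicontinuous; (4) $[u]_0=\overline{\{x: u(x)>0\}}$ is compact. Put $[u]_\alpha=\{x: u(x)\ge\alpha\}$ for $\alpha\in(0,1]$ and write $[u]_\alpha=[u_\alpha^-,u_\alpha^+]$. The left and right parts of $u$ are $u^\ell,u^r:\mathbb{R}\to[0,1]$: $u^\ell(x)=0$ for $x<u_0^-$, $u^\ell(x)=u(x)$ for $x\in[u_0^-,u_1^-]$, $u^\ell(x)=1$ for $x>u_1^-$; $u^r(x)=1$ for $x<u_1^-$, $u^r(x)=u(x)$ for $x\in[u_1^-,u_0^+]$, $u^r(x)=0$ for $x>u_0^+$. Define $P(u,v)=\inf_{x\in\mathbb{R}}\big((v^\ell(x)\to u^\ell(x))\wedge(u^r(x)\to v^r(x))\big)$. For $M>0$, $\mathbb{E}^1_{[-M,M]}$ is the set of $u\in\mathbb{E}^1$ with support $[u]_0\subseteq[-M,M]$.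 Enriched categories: a $[0,1]$-enriched category is a set $X$ with a map $X(-,-):X\times X\to[0,1]$ such that $X(x,x)=1$ and $X(y,z)\,\&\,X(x,y)\le X(x,z)$. Here $X=\mathbb{E}^1_{[-M,M]}$ and $X(u,v)=P(u,v)$. A weight is a map $\phi:X\to[0,1]$ with $X(y,x)\le\phi(x)\to\phi(y)$; a coweight is a map $\psi:X\to[0,1]$ with $X(x,y)\le\psi(x)\to\psi(y)$. A colimit of $\phi$ is an element $c$ with $X(c,x)=\inf_{y\in X}(\phi(y)\to X(y,x))$ for all $x$; a limit of $\psi$ is an element $l$ with $X(x,l)=\inf_{y\in X}(\psi(y)\to X(x,y))$ for all $x$. A weight is conical if it is $\sup_{a\in A}X(-,a)$ for a subset $A\subseteq X$; a coweight is conical if it is $\sup_{b\in B}X(b,-)$ for a subset $B\subseteq X$ (empty subsets allowed). $X$ is conically cocomplete if every conical weight has a colimit, and conically complete if every conical coweight has a limit. *)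

(* Defs.v *)
From HB Require Import structures.
From mathcomp Require Import all_boot all_order all_algebra.
From mathcomp Require Import all_classical all_reals all_analysis.
Set Implicit Arguments.
Unset Strict Implicit.
Unset Printing Implicit Defensive.
Import Order.TTheory GRing.Theory Num.Theory.
Import numFieldNormedType.Exports.
Local Open Scope classical_set_scope.
Local Open Scope ring_scope.

(* Suprema and infima in the complete lattice [0,1]: for A included in [0,1],
   adding the bottom (resp. top) element only matters for A = set0, where the
   supremum has to be 0 and the infimum 1. *)
Definition sup01 (R : realType) (A : set R) : R := sup (0 |` A).
Definition inf01 (R : realType) (A : set R) : R := inf (1 |` A).

(* The operation is only specified on [0,1]; its values elsewhere are junk. *)
Record tnorm (R : realType) := Tnorm {
  tnorm_op :> R -> R -> R;
  tnorm01 : forall x y, 0 <= x <= 1 -> 0 <= y <= 1 -> 0 <= tnorm_op x y <= 1;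
  tnormC : forall x y, 0 <= x <= 1 -> 0 <= y <= 1 ->
    tnorm_op x y = tnorm_op y x;
  tnormA : forall x y z, 0 <= x <= 1 -> 0 <= y <= 1 -> 0 <= z <= 1 ->
    tnorm_op x (tnorm_op y z) = tnorm_op (tnorm_op x y) z;
  tnorm_mono : forall x x' y y', 0 <= x <= 1 -> 0 <= x' <= 1 ->
    0 <= y <= 1 -> 0 <= y' <= 1 -> x <= x' -> y <= y' ->
    tnorm_op x y <= tnorm_op x' y';
  tnorm1 : forall x, 0 <= x <= 1 -> tnorm_op x 1 = x }.

Definition tnorm_continuous (R : realType) (T : tnorm R) : Prop :=
  {within (`[0, 1]%classic `*` `[0, 1]%classic : set (R * R)%type),
    continuous (fun p : R * R => T p.1 p.2)}.

Definition residuum (R : realType) (T : tnorm R) (x y : R) : R :=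
  sup01 [set t | 0 <= t <= 1 /\ T x t <= y].

(* [cut u 0] is the closure of the set of positivity, not [set x | 0 <= u x]. *)
Definition cut (R : realType) (u : R -> R) (a : R) : set R :=
  if a == 0 then closure [set x | 0 < u x] else [set x | a <= u x].

Definition upper_semicontinuous (R : realType) (u : R -> R) : Prop :=
  forall x a, u x < a -> \forall y \near x, u y < a.

Record fuzzy_number (R : realType) := FuzzyNumber {
  fuzzy_fun :> R -> R;
  fuzzy01 : forall x, 0 <= fuzzy_fun x <= 1;
  fuzzy_normal : exists x0, fuzzy_fun x0 = 1;
  fuzzy_convex : forall x y l, 0 <= l <= 1 ->
    Num.min (fuzzy_fun x) (fuzzy_fun y) <= fuzzy_fun (l * x + (1 - l) * y);
  fuzzy_usc : upper_semicontinuous fuzzy_fun;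
  fuzzy_compact : compact (cut fuzzy_fun 0) }.

(* The cuts of a fuzzy number are nonempty compact intervals, so these are the
   endpoints in [u]_a = [u_a^-, u_a^+]. *)
Definition cut_lower (R : realType) (u : fuzzy_number R) (a : R) : R :=
  inf (cut u a).
Definition cut_upper (R : realType) (u : fuzzy_number R) (a : R) : R :=
  sup (cut u a).

Definition left_part (R : realType) (u : fuzzy_number R) (x : R) : R :=
  if x < cut_lower u 0 then 0 else if x <= cut_lower u 1 then u x else 1.

Definition right_part (R : realType) (u : fuzzy_number R) (x : R) : R :=
  if x < cut_lower u 1 then 1 else if x <= cut_upper u 0 then u x else 0.

Definition fuzzy_hom (R : realType) (T : tnorm R) (u v : fuzzy_number R) : R :=
  inf01 (range (fun x => Num.min
    (residuum T (left_part v x) (left_part u x))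
    (residuum T (right_part u x) (right_part v x)))).

Definition fuzzy_within (R : realType) (M : R) : Type :=
  {u : fuzzy_number R | cut u 0 `<=` `[- M, M]%classic}.

Record enriched_category (R : realType) (T : tnorm R) := EnrichedCategory {
  obj :> Type;
  hom : obj -> obj -> R;
  hom01 : forall x y, 0 <= hom x y <= 1;
  hom_refl : forall x, hom x x = 1;
  hom_comp : forall x y z, T (hom y z) (hom x y) <= hom x z }.

Definition weight (R : realType) (T : tnorm R) (X : enriched_category T)
    (phi : X -> R) : Prop :=
  (forall x, 0 <= phi x <= 1) /\
  (forall x y, hom y x <= residuum T (phi x) (phi y)).

Definition coweight (R : realType) (T : tnorm R) (X : enriched_category T)
    (psi : X -> R) : Prop :=
  (forall x, 0 <= psi x <= 1) /\
  (forall x y, hom x y <= residuum T (psi x) (psi y)).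

Definition is_colimit (R : realType) (T : tnorm R) (X : enriched_category T)
    (phi : X -> R) (c : X) : Prop :=
  forall x, hom c x = inf01 (range (fun y => residuum T (phi y) (hom y x))).

Definition is_limit (R : realType) (T : tnorm R) (X : enriched_category T)
    (psi : X -> R) (l : X) : Prop :=
  forall x, hom x l = inf01 (range (fun y => residuum T (psi y) (hom x y))).

Definition conical_weight (R : realType) (T : tnorm R)
    (X : enriched_category T) (phi : X -> R) : Prop :=
  weight phi /\
  exists A : set X, forall x, phi x = sup01 [set hom x a | a in A].

Definition conical_coweight (R : realType) (T : tnorm R)
    (X : enriched_category T) (psi : X -> R) : Prop :=
  coweight psi /\
  exists B : set X, forall x, psi x = sup01 [set hom b x | b in B].

Definition conically_cocomplete (R : realType) (T : tnorm R)
    (X : enriched_category T) : Prop :=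
  forall phi : X -> R, conical_weight phi -> exists c : X, is_colimit phi c.

Definition conically_complete (R : realType) (T : tnorm R)
    (X : enriched_category T) : Prop :=
  forall psi : X -> R, conical_coweight psi -> exists l : X, is_limit psi l.

Lemma in01_0 (R : realType) : 0 <= (0 : R) <= 1.
Proof. by rewrite lexx ler01. Qed.

Lemma in01_1 (R : realType) : 0 <= (1 : R) <= 1.
Proof. by rewrite lexx ler01. Qed.

Lemma sup01_ub (R : realType) (A : set R) (x : R) :
  (forall y, A y -> y <= 1) -> A x -> x <= sup01 A.
Proof.
move=> A1 Ax; apply: ub_le_sup; last by right.
by exists 1 => y [->|/A1//]; exact: ler01.
Qed.

Lemma sup01_in01 (R : realType) (A : set R) :
  (forall y, A y -> y <= 1) -> 0 <= sup01 A <= 1.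
Proof.
move=> A1; have U : ubound (0 |` A) 1 by move=> y [->|/A1//]; exact: ler01.
apply/andP; split; first by apply: ub_le_sup; [exists 1|left].
by apply: ge_sup => //; exists 0; left.
Qed.

Lemma inf01_lb (R : realType) (A : set R) (x : R) :
  (forall y, A y -> 0 <= y) -> A x -> inf01 A <= x.
Proof.
move=> A0 Ax; apply: ge_inf; last by right.
by exists 0 => y [->|/A0//]; exact: ler01.
Qed.

Lemma le_inf01 (R : realType) (A : set R) (x : R) :
  x <= 1 -> (forall y, A y -> x <= y) -> x <= inf01 A.
Proof.
move=> x1 xA; apply: lb_le_inf; first by exists 1; left.
by move=> y [->|/xA].
Qed.

Lemma inf01_in01 (R : realType) (A : set R) :
  (forall y, A y -> 0 <= y) -> 0 <= inf01 A <= 1.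
Proof.
move=> A0; apply/andP; split; first exact: le_inf01.
apply: ge_inf; last by left.
by exists 0 => y [->|/A0//]; exact: ler01.
Qed.

Section Residuum.
Variables (R : realType) (T : tnorm R).

Lemma residuum01 x y : 0 <= residuum T x y <= 1.
Proof. by apply: sup01_in01 => t [/andP[]]. Qed.

Lemma le_residuum x y t : 0 <= t <= 1 -> T x t <= y -> t <= residuum T x y.
Proof. by move=> t01 xt; apply: sup01_ub => // s [/andP[]]. Qed.

Lemma residuumxx x : 0 <= x <= 1 -> residuum T x x = 1.
Proof.
move=> x01; apply/eqP; rewrite eq_le; have /andP[_ ->] := residuum01 x x.
by apply: le_residuum; rewrite ?in01_1 ?tnorm1.
Qed.

Lemma tnorm_residuum x y : tnorm_continuous T -> 0 <= x <= 1 -> 0 <= y <= 1 ->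
  T x (residuum T x y) <= y.
Proof.
move=> Tc x01 y01; rewrite leNgt; apply/negP => ylt.
have s01 := residuum01 x y.
set s := residuum T x y in ylt s01 *.
have Ds : (`[0, 1]%classic `*` `[0, 1]%classic : set (R * R)%type) (x, s).
  by split; rewrite /= in_itv.
have /cvgr_gt/(_ _ ylt) := (subspace_continuousP _ _).1 Tc (x, s) Ds.
move=> /nbhs_ballP[e /= e0 se].
have hs : has_sup (0 |` [set t | 0 <= t <= 1 /\ T x t <= y]).
  split; first by exists 0; left.
  by exists 1 => t [->|[/andP[]]//]; exact: ler01.
have [t tS st] := sup_adherent e0 hs.
have t01 : 0 <= t <= 1 by case: tS => [->|[]//]; exact: in01_0.
have Txt : T x t <= y.
  case: tS => [->|[]//].
  have := tnorm_mono T x01 (in01_1 R) (in01_0 R) (in01_0 R).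
  have /andP[_ x1] := x01; move=> /(_ x1 (lexx _)) Tx0.
  apply: (le_trans Tx0); rewrite tnormC ?in01_1 ?in01_0// tnorm1 ?in01_0//.
  by case/andP: y01.
have ts : t <= s by apply: ub_le_sup => //; case: hs.
suff : y < T x t by rewrite ltNge Txt.
apply: (se (x, t)); last by split; rewrite /= in_itv.
split; first exact: ballxx.
rewrite /ball /= ger0_norm ?subr_ge0// ltrBlDr addrC -ltrBlDr.
exact: st.
Qed.

Lemma residuum_comp x y z : tnorm_continuous T ->
  0 <= x <= 1 -> 0 <= y <= 1 -> 0 <= z <= 1 ->
  T (residuum T y z) (residuum T x y) <= residuum T x z.
Proof.
move=> Tc x01 y01 z01.
have ryz := residuum01 y z; have rxy := residuum01 x y.
apply: le_residuum; first exact: tnorm01.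
rewrite (tnormC T ryz rxy) (tnormA T x01 rxy ryz).
apply: le_trans (tnorm_residuum Tc y01 z01).
by apply: tnorm_mono; rewrite ?tnorm01 ?lexx ?tnorm_residuum.
Qed.

End Residuum.

Section FuzzyHom.
Variables (R : realType) (T : tnorm R).
Implicit Types u v w : fuzzy_number R.

Lemma left_part01 u x : 0 <= left_part u x <= 1.
Proof.
by rewrite /left_part; do 2?case: ifP; rewrite ?in01_0 ?in01_1 ?fuzzy01.
Qed.

Lemma right_part01 u x : 0 <= right_part u x <= 1.
Proof.
by rewrite /right_part; do 2?case: ifP; rewrite ?in01_0 ?in01_1 ?fuzzy01.
Qed.

Let hom_ge0 u v y : range (fun x => Num.min
    (residuum T (left_part v x) (left_part u x))
    (residuum T (right_part u x) (right_part v x))) y -> 0 <= y.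
Proof.
move=> [x _ <-]; rewrite le_min.
have /andP[-> _] := residuum01 T (left_part v x) (left_part u x).
by have /andP[-> _] := residuum01 T (right_part u x) (right_part v x).
Qed.

Lemma fuzzy_hom01 u v : 0 <= fuzzy_hom T u v <= 1.
Proof. by apply: inf01_in01; exact: hom_ge0. Qed.

Lemma fuzzy_hom_refl u : fuzzy_hom T u u = 1.
Proof.
apply/eqP; rewrite eq_le; have /andP[_ ->] := fuzzy_hom01 u u.
apply: le_inf01 => // _ [x _ <-].
by rewrite !residuumxx ?left_part01 ?right_part01// minxx.
Qed.

Lemma fuzzy_hom_comp u v w : tnorm_continuous T ->
  T (fuzzy_hom T v w) (fuzzy_hom T u v) <= fuzzy_hom T u w.
Proof.
move=> Tc; have vw := fuzzy_hom01 v w; have uv := fuzzy_hom01 u v.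
apply: le_inf01; first by case/andP: (tnorm01 T vw uv).
move=> _ [x _ <-].
have : fuzzy_hom T v w <= Num.min
    (residuum T (left_part w x) (left_part v x))
    (residuum T (right_part v x) (right_part w x)).
  by apply: inf01_lb; [exact: hom_ge0|exists x].
have : fuzzy_hom T u v <= Num.min
    (residuum T (left_part v x) (left_part u x))
    (residuum T (right_part u x) (right_part v x)).
  by apply: inf01_lb; [exact: hom_ge0|exists x].
rewrite !le_min => /andP[uvl uvr] /andP[vwl vwr]; apply/andP; split.
- have := residuum_comp Tc (left_part01 w x) (left_part01 v x) (left_part01 u x).
  apply: le_trans; rewrite (tnormC T vw uv).
  by apply: tnorm_mono; rewrite ?residuum01.
- have := residuum_comp Tc (right_part01 u x) (right_part01 v x)
    (right_part01 w x).
  by apply: le_trans; apply: tnorm_mono; rewrite ?residuum01.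
Qed.

Definition fuzzy_category (Tc : tnorm_continuous T) (M : R) :
    enriched_category T :=
  @EnrichedCategory R T (fuzzy_within M)
    (fun x y => fuzzy_hom T (sval x) (sval y))
    (fun x y => fuzzy_hom01 (sval x) (sval y))
    (fun x => fuzzy_hom_refl (sval x))
    (fun x y z => fuzzy_hom_comp (sval x) (sval y) (sval z) Tc).

End FuzzyHom.

(* Main.v *)
Require Import Defs.
From HB Require Import structures.
From mathcomp Require Import all_boot all_order all_algebra.
From mathcomp Require Import all_classical all_reals all_analysis.
From mathcomp Require Import lra.
Set Implicit Arguments.
Unset Strict Implicit.
Unset Printing Implicit Defensive.
Import Order.TTheory GRing.Theory Num.Theory.
Import numFieldNormedType.Exports.
(* Restores [hom] of an enriched category over [hom] of linear algebra. *)
Import Defs.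
Local Open Scope classical_set_scope.
Local Open Scope ring_scope.

(** By the Yoneda lemma, a colimit of the conical weight generated by a set [A]
    is an element [c] with [X(c, x) = inf_(a in A) X(a, x)], so conical
    cocompleteness amounts to the existence of such enriched suprema
    ([conically_cocomplete_inf]).

    A fuzzy number supported in [-M, M] is the same thing as a pair [(f, g)]
    made of its left part, nondecreasing and right-continuous, and its right
    part, nonincreasing and left-continuous, where [f] vanishes below [-M], [g]
    vanishes above [M], and both equal 1 at some common point
    ([parts_of_fuzzy], [exists_fuzzy_parts]); the pair gives back the fuzzy
    number as [min f g].  By residuation, [p <= P(u, v)] means that, pointwise,
    [v^l & p <= u^l] and [u^r & p <= v^r] ([le_fuzzy_homP]).  The left part of
    the supremum of [A] therefore has to be the infimum of the left parts,
    which is again right-continuous.  The supremum of the right parts need not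
    be left-continuous; it is replaced by its left-continuous regularization,
    which does not affect [P(c, x)] because [x^r] is left-continuous itself
    ([fuzzy_sup]).

    For limits, the reflection [u(x) |-> u(-x)] exchanges left and right parts
    and so reverses [P] ([hom_mirrored]).  It carries suprema to infima, that
    is, to suprema of the opposite category, whose conical colimits are the
    conical limits of the original one. *)

(** * Residuation and the unit interval *)

Section Residuation.
Context {R : realType} (T : tnorm R).

Lemma inf01_lt (S : set R) (a : R) :
  inf01 S < a -> 1 < a \/ exists2 y, S y & y < a.
Proof.
move=> Sa; have [|y [->|Sy] ya] := inf_lt _ Sa; first by exists 1; left.
- by left.
- by right; exists y.
Qed.

Lemma sup01_le (S : set R) (b : R) :
  0 <= b -> (forall y, S y -> y <= b) -> sup01 S <= b.
Proof.
move=> b0 Sb; apply: ge_sup; first by exists 0; left.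
by move=> y [->|/Sb].
Qed.

Lemma le_residuumP (Tc : tnorm_continuous T) (x y p : R) :
  0 <= x <= 1 -> 0 <= y <= 1 -> 0 <= p <= 1 ->
  p <= residuum T x y <-> T x p <= y.
Proof.
move=> x01 y01 p01; split; last exact: le_residuum.
move=> pxy; apply: le_trans (tnorm_residuum Tc x01 y01).
by apply: tnorm_mono; rewrite ?residuum01.
Qed.

Lemma tnorm0l (p : R) : 0 <= p <= 1 -> T 0 p = 0.
Proof.
move=> p01; have /andP[T0 _] := tnorm01 T (in01_0 R) p01.
apply/eqP; rewrite eq_le T0 andbT.
rewrite -{2}(tnorm1 T (in01_0 R)).
by apply: tnorm_mono; rewrite ?in01_0 ?in01_1//; case/andP: p01.
Qed.

End Residuation.

(** * Conical colimits as suprema *)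

Section ConicalColimits.
Context {R : realType} (T : tnorm R).

(** By the Yoneda lemma, the presheaf whose representability defines the
    colimit of the conical weight [sup_(a in A) X(-, a)] is
    [x |-> inf_(a in A) X(a, x)]. *)
Lemma conically_cocomplete_inf (Tc : tnorm_continuous T)
    (X : enriched_category T) :
  (forall A : set X, exists c : X,
    forall x, hom c x = inf01 [set hom a x | a in A]) ->
  conically_cocomplete X.
Proof.
move=> Xsup phi [[phi01 _] [A phiE]]; have [c cE] := Xsup A.
exists c => x; rewrite cE.
have homge0 (y : R) : [set hom a x | a in A] y -> 0 <= y.
  by move=> [a _ <-]; case/andP: (hom01 a x).
have p01 := inf01_in01 homge0.
have hom_le1 y z : [set hom y a | a in A] z -> z <= 1.
  by move=> [a _ <-]; case/andP: (hom01 y a).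
have resge0 (z : R) :
    range (fun y => residuum T (phi y) (hom y x)) z -> 0 <= z.
  by move=> [y _ <-]; case/andP: (residuum01 T (phi y) (hom y x)).
apply/eqP; rewrite eq_le; apply/andP; split.
- apply: le_inf01; first by case/andP: p01.
  (* Moving [phi y] across the adjunction turns its supremum over [A] into a
     condition on each [a], which is composition through [a]. *)
  move=> _ [y _ <-]; apply/(le_residuumP Tc) => //; first exact: hom01.
  rewrite tnormC//; apply/(le_residuumP Tc) => //; first exact: hom01.
  rewrite phiE; apply: sup01_le.
    by case/andP: (residuum01 T (inf01 [set hom a x | a in A]) (hom y x)).
  move=> _ [a Aa <-]; apply/(le_residuumP Tc); rewrite ?hom01//.
  apply: le_trans (hom_comp y a x).
  by apply: tnorm_mono; rewrite ?hom01//; apply: inf01_lb => //; exists a.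
- apply: le_inf01; first by case/andP: (inf01_in01 resge0).
  move=> _ [a Aa <-].
  have phia : phi a = 1.
    apply/eqP; rewrite eq_le; have /andP[_ ->] := phi01 a.
    rewrite phiE -(hom_refl a); apply: sup01_ub; first exact: hom_le1.
    by exists a.
  apply: (@le_trans _ _ (residuum T (phi a) (hom a x))).
    by apply: inf01_lb => //; exists a.
  rewrite -[leLHS](tnorm1 T) ?residuum01// tnormC ?residuum01 ?in01_1//.
  by rewrite -{1}phia tnorm_residuum// hom01.
Qed.

Lemma opposite_comp (X : enriched_category T) (x y z : X) :
  T (hom z y) (hom y x) <= hom z x.
Proof. by rewrite tnormC ?hom01// hom_comp. Qed.

Definition opposite (X : enriched_category T) : enriched_category T :=
  @EnrichedCategory R T X (fun x y : X => hom y x) (fun x y : X => hom01 y x)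
    (@hom_refl R T X) (@opposite_comp X).

Lemma conically_complete_opposite (X : enriched_category T) :
  conically_cocomplete (opposite X) -> conically_complete X.
Proof. exact. Qed.

End ConicalColimits.

(** * Fuzzy numbers and their left and right parts *)

Section Parts.
Context {R : realType}.

(** On a nondecreasing function, [rising_rcont] says both upper semicontinuity
    and right continuity. *)
Record rising (M : R) (f : R -> R) : Prop := Rising {
  rising01 : forall x, 0 <= f x <= 1;
  rising_homo : {homo f : x y / x <= y};
  rising_rcont : forall x a, f x < a -> exists2 y, x < y & f y < a;
  rising0 : forall x : R, x < - M -> f x = 0 }.

(** The right part is encoded through its reflection, so that one notion of
    profile serves both sides. *)
Definition parts (M : R) (f g : R -> R) : Prop :=
  [/\ rising M f, rising M (fun x => g (- x)) &
      exists x0, f x0 = 1 /\ g x0 = 1].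

Lemma parts_mirror (M : R) (f g : R -> R) :
  parts M f g -> parts M (fun x => g (- x)) (fun x => f (- x)).
Proof.
move=> [fM gM [x0 [f1 g1]]]; split => //; last by exists (- x0); rewrite !opprK.
by rewrite (_ : (fun x => f (- - x)) = f)//; apply/funext => x; rewrite opprK.
Qed.

Section PartsTheory.
Variables (M : R) (f g : R -> R).
Hypothesis fg : parts M f g.

Lemma parts01l x : 0 <= f x <= 1.
Proof. by case: fg => fM _ _; exact: rising01 fM _. Qed.

Lemma parts01r x : 0 <= g x <= 1.
Proof. by case: fg => _ /rising01 /(_ (- x)); rewrite opprK. Qed.

Lemma partsl_homo x y : x <= y -> f x <= f y.
Proof. by case: fg => fM _ _; exact: rising_homo fM _ _. Qed.

Lemma partsr_homo x y : x <= y -> g y <= g x.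
Proof.
move=> xy; case: fg => _ /rising_homo /(_ (- y) (- x)); rewrite !opprK lerN2.
by move=> /(_ xy).
Qed.

Lemma partsr_lcont x a : g x < a -> exists2 y, y < x & g y < a.
Proof.
case: fg => _ gM _; rewrite -{1}[x]opprK => /(rising_rcont gM)[y xy gy].
by exists (- y) => //; rewrite ltrNl.
Qed.

Lemma partsr0 x : M < x -> g x = 0.
Proof.
by case: fg => _ gM _ Mx; rewrite -[x]opprK (rising0 gM)// ltrN2.
Qed.

Lemma parts_core_ge x : f x = 1 -> - M <= x.
Proof.
move=> fx; rewrite leNgt; apply/negP => xM; case: fg => fM _ _.
by move: fx; rewrite (rising0 fM)// => /eqP; rewrite eq_sym oner_eq0.
Qed.

Lemma parts_core_le x : g x = 1 -> x <= M.
Proof.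
move=> gx; rewrite leNgt; apply/negP => Mx.
by move: gx; rewrite partsr0// => /eqP; rewrite eq_sym oner_eq0.
Qed.

Lemma partsr1 x : x <= - M -> g x = 1.
Proof.
move=> xM; case: fg => _ _ [x0 [fx0 gx0]].
apply/eqP; rewrite eq_le; have /andP[_ ->] := parts01r x.
by rewrite -gx0 partsr_homo// (le_trans xM)// parts_core_ge.
Qed.

End PartsTheory.

Section OfFuzzy.
Variables (M : R) (u : fuzzy_number R).
Hypothesis uM : cut u 0 `<=` `[- M, M]%classic.

Lemma fuzzy_between (x y z : R) : x <= y -> y <= z -> Num.min (u x) (u z) <= u y.
Proof.
move=> xy yz; have [xz|xz] := eqVneq x z.
  have -> : y = x by apply/le_anti; rewrite xy andbT xz.
  by rewrite ge_min lexx.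
have zx : 0 < z - x by rewrite subr_gt0 lt_neqAle xz (le_trans xy).
pose l := (z - y) / (z - x).
have lE : l * (z - x) = z - y by rewrite divfK// gt_eqF.
have -> : y = l * x + (1 - l) * z by lra.
apply: fuzzy_convex; apply/andP; split.
  by apply: divr_ge0; [rewrite subr_ge0|exact: ltW].
by rewrite ler_pdivrMr// mul1r; lra.
Qed.

Lemma cut1E : cut u 1 = [set x | 1 <= u x].
Proof. by rewrite /cut oner_eq0. Qed.

Lemma fuzzy_pos_cut0 (x : R) : 0 < u x -> cut u 0 x.
Proof. by rewrite /cut eqxx => ux; exact: subset_closure. Qed.

Lemma cut1_sub0 : cut u 1 `<=` cut u 0.
Proof. by rewrite cut1E => x /= ux; apply: fuzzy_pos_cut0; exact: lt_le_trans ux. Qed.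

Lemma cut1_inf : has_inf (cut u 1).
Proof.
split; first by have [x0 ux0] := fuzzy_normal u; exists x0; rewrite cut1E /= ux0.
by exists (- M) => x /cut1_sub0 /uM /=; rewrite in_itv /= => /andP[].
Qed.

Lemma cut0_bounded : has_lbound (cut u 0) /\ has_ubound (cut u 0).
Proof.
by split; [exists (- M)|exists M] => x /uM /=; rewrite in_itv /= => /andP[].
Qed.

(** Upper semicontinuity makes the lower endpoint of the core belong to it. *)
Lemma cut_lower1 : u (cut_lower u 1) = 1.
Proof.
apply/eqP; rewrite eq_le; have /andP[_ ->] /= := fuzzy01 u (cut_lower u 1).
rewrite leNgt; apply/negP => /(fuzzy_usc)/nbhs_ballP[e /= e0 ue].
have [x] := inf_adherent e0 cut1_inf.
rewrite {1}cut1E /= => ux xe; suff : u x < 1 by rewrite ltNge ux.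
apply: ue; rewrite /ball /= ltr_norml; apply/andP.
have : cut_lower u 1 <= x.
  by apply: ge_inf; rewrite ?cut1E//; case: cut1_inf; rewrite cut1E.
by rewrite /cut_lower in xe *; split; lra.
Qed.

(** Below [cut_lower u 0] the function itself vanishes, so the test against
    that endpoint can be dropped. *)
Lemma left_partE (x : R) :
  left_part u x = if x <= cut_lower u 1 then u x else 1.
Proof.
rewrite /left_part; case: ltP => // x0; have [bl _] := cut0_bounded.
have -> : x <= cut_lower u 1.
  apply: le_trans (ltW x0) _; apply: ge_inf => //; apply: cut1_sub0.
  by rewrite cut1E /= cut_lower1.
apply/esym/le_anti/andP; split; last by case/andP: (fuzzy01 u x).
rewrite leNgt; apply/negP => /fuzzy_pos_cut0 /(ge_inf bl).
by rewrite leNgt x0.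
Qed.

Lemma right_partE (x : R) :
  right_part u x = if x < cut_lower u 1 then 1 else u x.
Proof.
rewrite /right_part; case: ltP => // _; case: leP => // x0.
have [_ bu] := cut0_bounded.
apply/le_anti/andP; split; first by case/andP: (fuzzy01 u x).
rewrite leNgt; apply/negP => /fuzzy_pos_cut0 /(ub_le_sup bu).
by rewrite leNgt x0.
Qed.

Lemma parts_of_fuzzy : parts M (left_part u) (right_part u).
Proof.
have u_out x : (x < - M) || (M < x) -> u x = 0.
  move=> xM; apply/le_anti/andP; split; last by case/andP: (fuzzy01 u x).
  rewrite leNgt; apply/negP => /fuzzy_pos_cut0 /uM /=; rewrite in_itv /=.
  by move=> /andP[]; case/orP: xM; lra.
have u_le1 x : u x <= 1 by case/andP: (fuzzy01 u x).
have a1_M : - M <= cut_lower u 1 <= M.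
  have /cut1_sub0/uM : cut u 1 (cut_lower u 1) by rewrite cut1E /= cut_lower1.
  by rewrite /= in_itv.
case/andP: a1_M => Ma1 a1M.
set a1 := cut_lower u 1 in Ma1 a1M *.
have ua1 : u a1 = 1 := cut_lower1.
(* In both continuity proofs a value below [a <= 1] lies strictly off [a1],
   where the part agrees with [u]; the new point is kept on that side. *)
have uscE x a : u x < a -> exists2 e, 0 < e & forall y, `|x - y| < e -> u y < a.
  by move=> /fuzzy_usc /nbhs_ballP[e /= e0 ue]; exists e.
split.
- split.
  + by move=> x; rewrite left_part01.
  + move=> x y xy; rewrite !left_partE -/a1; case: (leP y a1) => ya.
      rewrite (le_trans xy ya).
      by have := fuzzy_between xy ya; rewrite ua1 (min_idPl _).
    by case: ifP.
  + move=> x a; have [a1'|a1'] := ltP 1 a.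
      move=> _; exists (x + 1); first by rewrite ltrDl.
      by apply: le_lt_trans a1'; case/andP: (left_part01 u (x + 1)).
    rewrite left_partE -/a1; case: (leP x a1) => [xa1|_]; last first.
      by rewrite ltNge a1'.
    move=> /[dup] uxa /uscE[e e0 ue]; have {}xa1 : x < a1.
      rewrite lt_neqAle xa1 andbT; apply/eqP => xE.
      by move: uxa; rewrite xE ua1 ltNge a1'.
    exists (Num.min (x + e / 2) a1); first by rewrite lt_min xa1 ltrDl divr_gt0.
    rewrite left_partE -/a1 ge_min lexx orbT; apply: ue.
    have : x < Num.min (x + e / 2) a1 by rewrite lt_min xa1 ltrDl divr_gt0.
    have : Num.min (x + e / 2) a1 <= x + e / 2 by rewrite ge_min lexx.
    by rewrite ltr_norml => ? ?; apply/andP; split; lra.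
  + by move=> x xM; rewrite left_partE -/a1 (le_trans (ltW xM) Ma1) u_out// xM.
- split.
  + by move=> x; rewrite right_part01.
  + move=> x y; rewrite -lerN2; move: (- x) (- y) => {}x {}y yx.
    rewrite !right_partE -/a1; case: (ltP y a1) => ya; first by case: ifP.
    rewrite ltNge (le_trans ya yx) /=.
    by have := fuzzy_between ya yx; rewrite ua1 (min_idPr _).
  + move=> x a; have [a1'|a1'] := ltP 1 a.
      move=> _; exists (x + 1); first by rewrite ltrDl.
      by apply: le_lt_trans a1'; case/andP: (right_part01 u (- (x + 1))).
    rewrite right_partE -/a1; case: (ltP (- x) a1) => [_|a1x].
      by rewrite ltNge a1'.
    move=> /[dup] uxa /uscE[e e0 ue]; have xa1 : a1 < - x.
      rewrite lt_neqAle a1x andbT; apply/eqP => xE.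
      by move: uxa; rewrite -xE ua1 ltNge a1'.
    have yE : x < Num.min (x + e / 2) (- a1).
      by rewrite lt_min ltrNr xa1 ltrDl divr_gt0.
    exists (Num.min (x + e / 2) (- a1)) => //.
    have ye : Num.min (x + e / 2) (- a1) <= x + e / 2 by rewrite ge_min lexx.
    have ya : Num.min (x + e / 2) (- a1) <= - a1 by rewrite ge_min lexx orbT.
    rewrite right_partE -/a1 ifF; last by rewrite ltNge lerNr ya.
    apply: ue.
    by rewrite ltr_norml; apply/andP; split; lra.
  + move=> x xM; rewrite right_partE -/a1 ltNge.
    have Mx : M < - x by rewrite ltrNr.
    by rewrite (le_trans a1M (ltW Mx)) /= u_out// Mx orbT.
- by exists a1; rewrite left_partE right_partE -/a1 lexx ltxx ua1.
Qed.

End OfFuzzy.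

Section OfParts.
Variables (M : R) (f g : R -> R).
Hypothesis fg : parts M f g.

Definition glue (x : R) : R := Num.min (f x) (g x).

Lemma glue01 x : 0 <= glue x <= 1.
Proof.
rewrite le_min ge_min; have /andP[-> ->] := parts01l fg x.
by have /andP[-> ->] := parts01r fg x.
Qed.

Lemma glue_normal : exists x0, glue x0 = 1.
Proof. by case: fg => _ _ [x0 [f1 g1]]; exists x0; rewrite /glue f1 g1 minxx. Qed.

Lemma glue_convex x y l : 0 <= l <= 1 ->
  Num.min (glue x) (glue y) <= glue (l * x + (1 - l) * y).
Proof.
move=> /andP[l0 l1].
have between a b c : a <= b -> b <= c -> Num.min (glue a) (glue c) <= glue b.
  move=> ab bc; rewrite /glue le_min !ge_min.
  by rewrite (partsl_homo fg ab) (partsr_homo fg bc) !orbT.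
have [xy|/ltW yx] := leP x y; first by apply: between; nra.
by rewrite minC; apply: between; nra.
Qed.

Lemma glue_usc : upper_semicontinuous glue.
Proof.
move=> x a; rewrite /glue gt_min => /orP[fx|gx].
- case: (fg) => fM _ _; have [y xy fy] := rising_rcont fM fx.
  near=> z; rewrite gt_min; apply/orP; left; apply: le_lt_trans fy.
  apply: (partsl_homo fg); apply: ltW; near: z; exact: lt_nbhsl.
- have [y yx gy] := partsr_lcont fg gx.
  near=> z; rewrite gt_min; apply/orP; right; apply: le_lt_trans gy.
  apply: (partsr_homo fg); apply: ltW; near: z; exact: lt_nbhsr.
Unshelve. all: by end_near. Qed.

Lemma glue_support : closure [set x | 0 < glue x] `<=` `[- M, M]%classic.
Proof.
have /closure_id -> : closed `[- M, M]%classic by exact: itv_closed.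
apply: closure_subset => x /=; rewrite in_itv /= lt_min => /andP[fx gx].
rewrite !leNgt; apply/andP; split; apply/negP => xM.
- by case: (fg) => fM _ _; rewrite (rising0 fM) ?ltxx in fx.
- by rewrite (partsr0 fg) ?ltxx in gx.
Qed.

Lemma glue_compact : compact (cut glue 0).
Proof.
rewrite /cut eqxx; apply: subclosed_compact glue_support.
- exact: closed_closure.
- exact: segment_compact.
Qed.

Definition fuzzy_of_parts : fuzzy_number R :=
  FuzzyNumber glue01 glue_normal glue_convex glue_usc glue_compact.

Lemma fuzzy_of_parts_support : cut fuzzy_of_parts 0 `<=` `[- M, M]%classic.
Proof. by rewrite /cut eqxx; exact: glue_support. Qed.

Let core := cut_lower fuzzy_of_parts 1.

(** Since both profiles are 1 at [core], [g] is 1 to its left and [f] is 1 to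
    its right, so on each side [glue] is the other profile. *)
Let core_fg : f core = 1 /\ g core = 1.
Proof.
have := cut_lower1 fuzzy_of_parts_support; rewrite -/core /= /glue => fg1.
have /andP[_ f1] := parts01l fg core.
have /andP[_ g1] := parts01r fg core.
have : 1 <= Num.min (f core) (g core) by rewrite fg1.
by rewrite le_min => /andP[? ?]; split; apply/le_anti/andP.
Qed.

Lemma left_fuzzy_of_parts x : left_part fuzzy_of_parts x = f x.
Proof.
rewrite (left_partE fuzzy_of_parts_support) -/core /= /glue.
have [f1 g1] := core_fg.
have /andP[_ fx1] := parts01l fg x.
case: leP => [xc|cx].
- have := partsr_homo fg xc; rewrite g1 => gx.
  by apply/min_idPl/(le_trans fx1).
- by apply/le_anti; rewrite fx1 -{1}f1 (partsl_homo fg)// ltW.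
Qed.

Lemma right_fuzzy_of_parts x : right_part fuzzy_of_parts x = g x.
Proof.
rewrite (right_partE fuzzy_of_parts_support) -/core /= /glue.
have [f1 g1] := core_fg.
have /andP[_ gx1] := parts01r fg x.
case: ltP => [xc|cx].
- by apply/le_anti; rewrite gx1 -{1}g1 (partsr_homo fg)// ltW.
- have := partsl_homo fg cx; rewrite f1 => fx.
  by apply/min_idPr/(le_trans gx1).
Qed.

End OfParts.

Lemma exists_fuzzy_parts (M : R) (f g : R -> R) : parts M f g ->
  exists u : fuzzy_within M,
    (forall x, left_part (sval u) x = f x) /\
    (forall x, right_part (sval u) x = g x).
Proof.
move=> fg; exists (exist (fun u : fuzzy_number R => cut u 0 `<=` _)
  (fuzzy_of_parts fg) (@fuzzy_of_parts_support _ _ _ fg)).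
split; [exact: left_fuzzy_of_parts|exact: right_fuzzy_of_parts].
Qed.

End Parts.

(** * Suprema of sets of fuzzy numbers *)

Section Suprema.
Context {R : realType} (T : tnorm R) (M : R).
Hypothesis (Tc : tnorm_continuous T) (M_gt0 : 0 < M).
Implicit Types u v : fuzzy_number R.

Lemma le_fuzzy_homP u v (p : R) : 0 <= p <= 1 ->
  p <= fuzzy_hom T u v <->
  forall x, T (left_part v x) p <= left_part u x /\
            T (right_part u x) p <= right_part v x.
Proof.
move=> p01; split=> [puv x|uvp].
- suff : p <= Num.min (residuum T (left_part v x) (left_part u x))
                      (residuum T (right_part u x) (right_part v x)).
    rewrite le_min => /andP[pl pr].
    by split; apply/(le_residuumP Tc); rewrite ?left_part01 ?right_part01.
  apply: le_trans puv _; apply: inf01_lb; last by exists x.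
  move=> _ [y _ <-]; rewrite le_min.
  have /andP[-> _] := residuum01 T (left_part v y) (left_part u y).
  by have /andP[-> _] := residuum01 T (right_part u y) (right_part v y).
- apply: le_inf01; first by case/andP: p01.
  move=> _ [x _ <-]; rewrite le_min; have [pl pr] := uvp x.
  by apply/andP; split; apply/(le_residuumP Tc);
    rewrite ?left_part01 ?right_part01.
Qed.

(** For a nondecreasing [h] with values in [0,1] this is the right limit, that
    is, the upper semicontinuous envelope of [h]. *)
Definition rreg (h : R -> R) (x : R) : R :=
  inf01 [set h s | s in [set s | x < s]].

Lemma rising_rreg (h : R -> R) : (forall x, 0 <= h x) ->
  (forall x : R, x < - M -> h x = 0) -> rising M (rreg h).
Proof.
move=> h0 hM; have hge0 x y : [set h s | s in [set s | x < s]] y -> 0 <= y.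
  by move=> [s _ <-].
split.
- by move=> x; apply: inf01_in01; exact: hge0.
- move=> x y xy; apply: le_inf01.
    by have /andP[] := inf01_in01 (hge0 x).
  move=> _ [s /= ys <-]; apply: inf01_lb; first exact: hge0.
  by exists s => //=; exact: le_lt_trans ys.
- move=> x a /inf01_lt[a1|[_ [s /= xs <-] hs]].
    exists (x + 1); first by rewrite ltrDl.
    by apply: le_lt_trans a1; have /andP[] := inf01_in01 (hge0 (x + 1)).
  exists ((x + s) / 2); first lra.
  apply: le_lt_trans hs; apply: inf01_lb; first exact: hge0.
  by exists s => //=; lra.
- move=> x xM; have /andP[r0 _] := inf01_in01 (hge0 x).
  apply/le_anti; rewrite r0 andbT -(hM ((x - M) / 2)); last lra.
  by apply: inf01_lb; [exact: hge0|exists ((x - M) / 2) => //=; lra].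
Qed.

Section SupParts.
Variable A : set (fuzzy_within M).

Let parts_of (a : fuzzy_within M) :
  parts M (left_part (sval a)) (right_part (sval a)).
Proof. exact: parts_of_fuzzy (svalP a). Qed.

(** The tests against [- M] make the empty supremum the indicator of [- M],
    the least element; otherwise they change nothing. *)
Definition sup_left (x : R) : R :=
  if x < - M then 0 else inf01 [set left_part (sval a) x | a in A].

Definition sup_right_raw (x : R) : R :=
  if x <= - M then 1 else sup01 [set right_part (sval a) x | a in A].

Definition sup_right (x : R) : R := rreg (fun s => sup_right_raw (- s)) (- x).

Let left_ge0 x y : [set left_part (sval a) x | a in A] y -> 0 <= y.
Proof. by move=> [a _ <-]; case/andP: (left_part01 (sval a) x). Qed.

Let right_le1 x y : [set right_part (sval a) x | a in A] y -> y <= 1.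
Proof. by move=> [a _ <-]; case/andP: (right_part01 (sval a) x). Qed.

Lemma sup_right_raw01 x : 0 <= sup_right_raw x <= 1.
Proof.
rewrite /sup_right_raw; case: ifP => _; first exact: in01_1.
by apply: sup01_in01; exact: right_le1.
Qed.

Lemma sup_right_raw_ub a x : A a -> right_part (sval a) x <= sup_right_raw x.
Proof.
move=> Aa; rewrite /sup_right_raw; case: ifP => _.
  by case/andP: (right_part01 (sval a) x).
by apply: sup01_ub; [exact: right_le1|exists a].
Qed.

Lemma sup_right_le_raw s x : s < x -> sup_right x <= sup_right_raw s.
Proof.
move=> sx; apply: inf01_lb; last by exists (- s); rewrite /= ?opprK ?ltrN2.
by move=> _ [y _ <-]; case/andP: (sup_right_raw01 (- y)).
Qed.

Lemma le_sup_right p x : p <= 1 -> (forall s, s < x -> p <= sup_right_raw s) ->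
  p <= sup_right x.
Proof.
move=> p1 ps; apply: le_inf01 => // _ [s /= xs <-]; apply: ps.
by rewrite ltrNl.
Qed.

Lemma sup_left_lb a x : A a -> sup_left x <= left_part (sval a) x.
Proof.
move=> Aa; rewrite /sup_left; case: ifP => _.
  by case/andP: (left_part01 (sval a) x).
by apply: inf01_lb; [exact: left_ge0|exists a].
Qed.

Lemma rising_sup_left : rising M sup_left.
Proof.
have sup01' x : 0 <= sup_left x <= 1.
  rewrite /sup_left; case: ifP => _; first exact: in01_0.
  by apply: inf01_in01; exact: left_ge0.
split=> //.
- move=> x y xy; rewrite {1}/sup_left; case: ltP => xM.
    by case/andP: (sup01' y).
  rewrite /sup_left ltNge (le_trans xM xy) /=; apply: le_inf01.
    by have /andP[] := inf01_in01 (@left_ge0 x).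
  move=> _ [a Aa <-].
  apply: (@le_trans _ _ (left_part (sval a) x)).
    by apply: inf01_lb; [exact: left_ge0|exists a].
  exact: (partsl_homo (parts_of a)).
- move=> x a; rewrite {1}/sup_left; case: (ltP x (- M)) => xM.
    move=> a0; exists ((x - M) / 2); first lra.
    by rewrite /sup_left ifT//; lra.
  move=> /inf01_lt[a1|[_ [b Ab <-] bx]].
    exists (x + 1); first by rewrite ltrDl.
    by apply: le_lt_trans a1; case/andP: (sup01' (x + 1)).
  have [bM _ _] := parts_of b; have [y xy yb] := rising_rcont bM bx.
  by exists y => //; apply: le_lt_trans yb; exact: sup_left_lb.
- by move=> x xM; rewrite /sup_left xM.
Qed.

Lemma rising_sup_right : rising M (fun x => sup_right (- x)).
Proof.
have -> : (fun x => sup_right (- x)) = rreg (fun s => sup_right_raw (- s)).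
  by apply/funext => x; rewrite /sup_right opprK.
apply: rising_rreg => [x|x xM]; first by case/andP: (sup_right_raw01 (- x)).
rewrite /sup_right_raw ifF; last first.
  by apply/negbTE; rewrite -ltNge ltrN2 (lt_trans xM) ?gtrN.
apply/le_anti/andP; split; last by have /andP[] := sup01_in01 (@right_le1 (- x)).
apply: sup01_le => // _ [a Aa <-].
by rewrite (partsr0 (parts_of a))// ltrNr.
Qed.

(** The witness is the supremum of points in the cores of the members of [A]:
    every left part is 1 there, and at each smaller point some right part is
    1, a value that the left-continuous regularization keeps. *)
Lemma sup_core : exists x0, sup_left x0 = 1 /\ sup_right x0 = 1.
Proof.
pose S : set R := [set x | x = - M \/ exists2 a, A a &
  left_part (sval a) x = 1 /\ right_part (sval a) x = 1].
have S_M x : S x -> x <= M.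
  move=> [->|[a _ [_ r1]]]; first by have := M_gt0; lra.
  exact: (parts_core_le (parts_of a) r1).
have hsS : has_sup S by split; [exists (- M); left|exists M => x; exact: S_M].
have Sub x : S x -> x <= sup S by move=> Sx; apply: ub_le_sup => //; case: hsS.
have le1 h : rising M h -> forall x, h x <= 1.
  by move=> hM x; case/andP: (rising01 hM x).
exists (sup S); split; apply/le_anti/andP; split.
- exact: le1 rising_sup_left _.
- rewrite /sup_left ltNge Sub /=; last by left.
  apply: le_inf01 => // _ [a Aa <-].
  have [_ _ [x [l1 r1]]] := parts_of a; rewrite -l1.
  by apply: (partsl_homo (parts_of a)); apply: Sub; right; exists a.
- by have := le1 _ rising_sup_right (- sup S); rewrite opprK.
- apply: le_sup_right => // s sS.
  have [x Sx sx] := sup_gt (proj1 hsS) sS.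
  case: Sx => [xM|[a Aa [_ r1]]].
    by rewrite /sup_right_raw ifT // ltW // -xM.
  apply: le_trans (sup_right_raw_ub _ Aa); rewrite -r1.
  by apply: (partsr_homo (parts_of a)); exact: ltW.
Qed.

Lemma parts_sup : parts M sup_left sup_right.
Proof. split; [exact: rising_sup_left|exact: rising_sup_right|exact: sup_core]. Qed.

(** Regularizing the pointwise supremum of the right parts does not change the
    bound [T (sup_right_raw s) p <= right_part x s], as the right part of [x]
    is itself left-continuous. *)
Lemma fuzzy_sup : exists c : fuzzy_category Tc M,
  forall x, hom c x = inf01 [set hom a x | a in (A : set (fuzzy_category Tc M))].
Proof.
have [c [cl cr]] := exists_fuzzy_parts parts_sup.
exists c => x; apply/le_anti/andP; split.
- apply: le_inf01; first by case/andP: (hom01 (c : fuzzy_category Tc M) x).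
  move=> _ [a Aa <-] /=; have p01 := fuzzy_hom01 T (sval c) (sval x).
  apply/le_fuzzy_homP => // t.
  have [Tl Tr] := (le_fuzzy_homP (sval c) (sval x) p01).1 (lexx _) t.
  split; first by apply: le_trans Tl _; rewrite cl; exact: sup_left_lb.
  apply: le_trans Tr; apply: tnorm_mono; rewrite ?right_part01//.
  rewrite cr; apply: le_sup_right; first by case/andP: (right_part01 (sval a) t).
  move=> s st; apply: le_trans (sup_right_raw_ub _ Aa).
  by apply: (partsr_homo (parts_of a)); exact: ltW.
- have hom_ge0 y :
      [set hom a x | a in (A : set (fuzzy_category Tc M))] y -> 0 <= y.
    by move=> [a _ <-]; case/andP: (hom01 a x).
  set p := inf01 _; have p01 : 0 <= p <= 1 := inf01_in01 hom_ge0.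
  have pA a t : A a ->
      T (left_part (sval x) t) p <= left_part (sval a) t /\
      T (right_part (sval a) t) p <= right_part (sval x) t.
    move=> Aa; apply: (le_fuzzy_homP (sval a) (sval x) p01).1.
    by apply: inf01_lb; [exact: hom_ge0|exists a].
  apply/le_fuzzy_homP => // t; rewrite cl cr; split.
  + rewrite /sup_left; case: ifP => tM.
      have [xM _ _] := parts_of x.
      by rewrite (rising0 xM)// tnorm0l.
    apply: le_inf01.
      by have /andP[] := tnorm01 T (left_part01 (sval x) t) p01.
    by move=> _ [a Aa <-]; case: (pA a t Aa).
  + (* A failure at [t] would, by left continuity of the right part of [x],
       persist at some [s < t], where the raw supremum bounds [sup_right t]. *)
    have c01 : 0 <= sup_right t <= 1 by rewrite -cr right_part01.
    rewrite leNgt; apply/negP => /(partsr_lcont (parts_of x))[s st].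
    apply/negP; rewrite -leNgt.
    apply: (@le_trans _ _ (T (sup_right_raw s) p)).
      apply: tnorm_mono; rewrite ?sup_right_raw01//; exact: sup_right_le_raw.
    rewrite /sup_right_raw; case: ifP => sM.
      rewrite (partsr1 (parts_of x))//.
      by case/andP: (tnorm01 T (in01_1 R) p01).
    have r01 := right_part01 (sval x) s.
    have g01 := sup01_in01 (@right_le1 s).
    rewrite tnormC//; apply/(le_residuumP Tc) => //.
    apply: sup01_le.
      by case/andP: (residuum01 T p (right_part (sval x) s)).
    move=> _ [a Aa <-]; apply/(le_residuumP Tc); rewrite ?right_part01//.
    by rewrite tnormC ?right_part01//; case: (pA a s Aa).
Qed.

End SupParts.
End Suprema.

(** * Reflection *)

Section Reflection.
Context {R : realType} (T : tnorm R) (M : R) (Tc : tnorm_continuous T).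

Definition mirrored (u v : fuzzy_number R) : Prop :=
  forall x, left_part v x = right_part u (- x) /\
            right_part v x = left_part u (- x).

Lemma mirroredC u v : mirrored u v -> mirrored v u.
Proof. by move=> uv x; have [l r] := uv (- x); rewrite l r opprK. Qed.

Lemma exists_mirrored (u : fuzzy_within M) :
  exists v : fuzzy_within M, mirrored (sval u) (sval v).
Proof.
have /parts_mirror/exists_fuzzy_parts[v [vl vr]] := parts_of_fuzzy (svalP u).
by exists v => x; rewrite vl vr.
Qed.

(** Reflection exchanges the two conditions of [le_fuzzy_homP], one of which is
    contravariant and the other covariant. *)
Lemma hom_mirrored u u' v v' : mirrored u u' -> mirrored v v' ->
  fuzzy_hom T u' v' = fuzzy_hom T v u.
Proof.
have le a a' b b' : mirrored a a' -> mirrored b b' ->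
    fuzzy_hom T b a <= fuzzy_hom T a' b'.
  move=> aa' bb'; apply/(le_fuzzy_homP Tc); first exact: fuzzy_hom01.
  move=> x; have [-> ->] := aa' x; have [-> ->] := bb' x.
  by have [] := (le_fuzzy_homP Tc b a (fuzzy_hom01 T b a)).1 (lexx _) (- x).
move=> uu' vv'; apply/le_anti; rewrite (le u) // andbT.
by apply: le; exact: mirroredC.
Qed.

End Reflection.

Unset Implicit Arguments.

Theorem proposition4p2 (R : realType) (T : tnorm R)
    (Tc : tnorm_continuous T) (M : R) (M_gt0 : 0 < M) :
  conically_cocomplete (fuzzy_category Tc M) /\
  conically_complete (fuzzy_category Tc M).
Proof.
split; first by apply: conically_cocomplete_inf => // A; exact: fuzzy_sup.
apply: conically_complete_opposite; apply: conically_cocomplete_inf => // B.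
have /choice[rho rhoP] := @exists_mirrored R M.
have [c cE] := fuzzy_sup Tc M_gt0 (rho @` B).
(* The infimum of [B] is the reflection of the supremum of the reflections. *)
exists (rho c) => x /=.
rewrite (hom_mirrored Tc (mirroredC (rhoP x)) (rhoP c)).
rewrite [LHS](cE (rho x)) image_comp; congr inf01; apply: eq_imagel => b _ /=.
exact: (hom_mirrored Tc (rhoP b) (rhoP x)).
Qed.
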